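(* Every epimorphism of rings $u:A\to B$ is a strong PSI-morphism.
   Context: All rings are commutative and unitary, and ring morphisms are unitary. A ring morphism $u:A\to B$ is an epimorphism if the canonical multiplication map $B\otimes_A B\to B$ is an isomorphism. For $P\in\mathrm{Spec}(A)$, $k_A(P)=A_P/PA_P$ denotes the residue field of $A$ at $P$. A ring morphism $u:A\to B$ is a strong PSI-morphism if for every $P\in\mathrm{Spec}(A)$ with $k_A(P)\otimes_A B\neq 0$, the canonical map $k_A(P)\to k_A(P)\otimes_A B$ is an isomorphism. *)

(* Defs.v *)
From HB Require Import structures.
From mathcomp Require Import all_boot all_algebra.
From mathcomp Require Import generic_quotient ring_quotient boolp.
From mathcomp Require Import freeg ring.

Set Implicit Arguments.
Unset Strict Implicit.
Unset Printing Implicit Defensive.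

Import GRing.Theory.
Local Open Scope ring_scope.
Local Open Scope quotient_scope.

(* Commutative unitary rings are [comPzRingType], so that the zero ring is     *)
(* allowed.  The prime ideals of ring_quotient.v live over [nzRingType] only,  *)
(* whence the record [Spec] below; the tensor product and the localization at  *)
(* a prime are not in the libraries.                                           *)

Section Tensor.
Variables (A B C : comPzRingType).
Variables (u : {rmorphism A -> B}) (v : {rmorphism A -> C}).
Local Notation F := {freeg (B * C)%type / int}.

Inductive tensor_rel : F -> Prop :=
| tensor_relDl b b' c :
    tensor_rel (<<(b + b', c)>> - (<<(b, c)>> + <<(b', c)>>))
| tensor_relDr b c c' :
    tensor_rel (<<(b, c + c')>> - (<<(b, c)>> + <<(b, c')>>))
| tensor_relA a b c :
    tensor_rel (<<(u a * b, c)>> - <<(b, v a * c)>>).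

(* The subgroup generated by [tensor_rel]. *)
Definition tensor_ker : {pred F} := fun D =>
  `[< forall S : zmodClosed F, (forall R, tensor_rel R -> R \in S) -> D \in S >].

Lemma tensor_ker_closed : zmod_closed tensor_ker.
Proof.
split=> [|x y /asboolP xK /asboolP yK]; apply/asboolP => S SR.
  exact: rpred0.
by rewrite rpredB ?xK ?yK.
Qed.
HB.instance Definition _ := GRing.isZmodClosed.Build F tensor_ker tensor_ker_closed.

(* [tensor u v] is the tensor product of B and C over A, where B and C are     *)
(* A-algebras through u and v.                                                 *)
Definition tensor : Type := Quotient.quot tensor_ker.
HB.instance Definition _ := Choice.on tensor.
HB.instance Definition _ := GRing.Zmodule.on tensor.

Definition tpure (b : B) (c : C) : tensor := \pi_(Quotient.quot tensor_ker) <<(b, c)>>.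

Lemma tensor_rel0 R : tensor_rel R -> \pi_(Quotient.quot tensor_ker) R = 0.
Proof.
move=> RR; rewrite -[RHS](raddf0 (\pi_(Quotient.quot tensor_ker))); apply/eqP.
by rewrite -Quotient.idealrBE subr0; apply/asboolP => S; exact.
Qed.

Lemma tpureDl b b' c : tpure (b + b') c = tpure b c + tpure b' c.
Proof.
by apply/eqP; rewrite -subr_eq0 /tpure -raddfD -raddfB /= tensor_rel0 //; constructor.
Qed.

Lemma tpureDr b c c' : tpure b (c + c') = tpure b c + tpure b c'.
Proof.
by apply/eqP; rewrite -subr_eq0 /tpure -raddfD -raddfB /= tensor_rel0 //; constructor.
Qed.

Lemma tpureA a b c : tpure (u a * b) c = tpure b (v a * c).
Proof.
by apply/eqP; rewrite -subr_eq0 /tpure -raddfB /= tensor_rel0 //; constructor.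
Qed.

Lemma tensor_ind (Q : tensor -> Prop) :
  Q 0 -> (forall x y, Q x -> Q y -> Q (x - y)) -> (forall b c, Q (tpure b c)) ->
  forall t, Q t.
Proof.
move=> Q0 QB Qp.
have QN x : Q x -> Q (- x) by rewrite -sub0r; exact: QB.
have QD x y : Q x -> Q y -> Q (x + y).
  by move=> Qx Qy; rewrite -[y]opprK; apply: QB => //; exact: QN.
have QMn x n : Q x -> Q (x *+ n).
  by move=> Qx; elim: n => [|n IH]; rewrite ?mulr0n // mulrS; apply: QD.
move=> t; rewrite -[t]reprK; elim/freeg_ind_dom0: (repr t) => [|k x D _ _ IH].
  by rewrite raddf0.
rewrite raddfD /=; apply: QD IH.
have -> : << k *g x >> = <<x>> *~ k :> F by rewrite freegU_mulz intz.
rewrite raddfMz; case: x => b c; case: k => n.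
  exact/QMn/Qp.
rewrite NegzE mulrNz; exact/QN/QMn/Qp.
Qed.

(* The universal property: [tensor_lift f] is the map induced by f when f is   *)
(* biadditive and A-balanced.                                                  *)
Section Lift.
Variables (V : zmodType) (f : B -> C -> V).

Definition balanced := [/\ forall b b' c, f (b + b') c = f b c + f b' c,
  forall b c c', f b (c + c') = f b c + f b c' &
  forall a b c, f (u a * b) c = f b (v a * c)].

Definition tensor_lift (t : tensor) : V :=
  fglift (fun x : B * C => f x.1 x.2 : zmodule V) (repr t).

Hypothesis fP : balanced.
Let g : F -> V := fglift (fun x : B * C => f x.1 x.2 : zmodule V).

Let gB : zmod_morphism g.
Proof.
move=> x y.
exact: (lift_is_additive (fun x : B * C => f x.1 x.2 : zmodule V) x y).
Qed.

Let gU b c : g <<(b, c)>> = f b c.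
Proof. by rewrite /g liftU scale1r. Qed.

Let g_ker D : D \in tensor_ker -> g D = 0.
Proof.
have g0 : g 0 = 0 by move: (gB 0 0); rewrite !subrr.
have gD x y : g (x + y) = g x + g y.
  by rewrite -{1}[y]opprK gB -[- y]sub0r gB g0 sub0r opprK.
pose S := fun D => g D == 0.
have Scl : zmod_closed S.
  split=> [|x y]; rewrite !unfold_in /S ?g0 // => /eqP gx /eqP gy.
  by rewrite gB gx gy subrr.
pose SI := GRing.isZmodClosed.Build F S Scl.
pose SZ : zmodClosed F := HB.pack S SI.
move/asboolP/(_ SZ) => H; apply/eqP/H => R.
have [fDl fDr fA] := fP.
by case=> *; rewrite unfold_in /= /S gB ?gD !gU ?fDl ?fDr ?fA subrr.
Qed.

Let lift_pi D : tensor_lift (\pi_(Quotient.quot tensor_ker) D) = g D.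
Proof.
apply/eqP; rewrite -subr_eq0 -gB g_ker //.
by rewrite Quotient.idealrBE reprK.
Qed.

Lemma tensor_lift_pure b c : tensor_lift (tpure b c) = f b c.
Proof. by rewrite /tpure lift_pi gU. Qed.

Lemma tensor_liftB : zmod_morphism tensor_lift.
Proof.
move=> s t; rewrite -[s]reprK -[t]reprK -[X in tensor_lift X]raddfB.
by rewrite !lift_pi gB.
Qed.

Lemma tensor_lift0 : tensor_lift 0 = 0.
Proof. by move: (tensor_liftB 0 0); rewrite !subrr. Qed.

Lemma tensor_liftD s t : tensor_lift (s + t) = tensor_lift s + tensor_lift t.
Proof.
by rewrite -{1}[t]opprK tensor_liftB -[- t]sub0r tensor_liftB tensor_lift0 sub0r opprK.
Qed.

End Lift.

Lemma tensor_lift_ext (V : zmodType) (f f' : B -> C -> V) t :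
  (forall b c, f b c = f' b c) -> tensor_lift f t = tensor_lift f' t.
Proof. by move=> e; congr (tensor_lift _ t); apply/funext => b; apply/funext. Qed.

Definition tmulr (b : B) (c : C) (t : tensor) : tensor :=
  tensor_lift (fun b' c' => tpure (b * b') (c * c')) t.
Definition tmul (s t : tensor) : tensor := tensor_lift (fun b c => tmulr b c t) s.
Definition tone : tensor := tpure 1 1.

Let tmulr_bal b c : balanced (fun b' c' => tpure (b * b') (c * c')).
Proof.
by split=> *; rewrite ?mulrDr ?tpureDl ?tpureDr // mulrCA tpureA mulrCA.
Qed.

Let tmulr_pure b c b' c' : tmulr b c (tpure b' c') = tpure (b * b') (c * c').
Proof. exact/tensor_lift_pure/tmulr_bal. Qed.

Let tmulrB b c : zmod_morphism (tmulr b c).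
Proof. exact/tensor_liftB/tmulr_bal. Qed.

Let tmulr0 b c : tmulr b c 0 = 0.
Proof. exact/tensor_lift0/tmulr_bal. Qed.

Let subDD (V : zmodType) (x y x' y' : V) : x + y - (x' + y') = (x - x') + (y - y').
Proof. by rewrite opprD addrACA. Qed.

Let tmul_bal t : balanced (fun b c => tmulr b c t).
Proof.
split=> [b b' c|b c c'|a b c]; elim/tensor_ind: t => [|x y Hx Hy|d e].
- by rewrite !tmulr0 addr0.
- by rewrite !tmulrB Hx Hy subDD.
- by rewrite !tmulr_pure mulrDl tpureDl.
- by rewrite !tmulr0 addr0.
- by rewrite !tmulrB Hx Hy subDD.
- by rewrite !tmulr_pure mulrDl tpureDr.
- by rewrite !tmulr0.
- by rewrite !tmulrB Hx Hy.
- by rewrite !tmulr_pure -!mulrA tpureA.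
Qed.

Let tmul_pure b c t : tmul (tpure b c) t = tmulr b c t.
Proof. exact: (tensor_lift_pure (tmul_bal t)). Qed.

Lemma tpureM b c b' c' : tmul (tpure b c) (tpure b' c') = tpure (b * b') (c * c').
Proof. by rewrite tmul_pure tmulr_pure. Qed.

Let tmulBl s s' t : tmul (s - s') t = tmul s t - tmul s' t.
Proof. exact: (tensor_liftB (tmul_bal t)). Qed.

Let tmul0l t : tmul 0 t = 0.
Proof. exact: (tensor_lift0 (tmul_bal t)). Qed.

Let tmul0r t : tmul t 0 = 0.
Proof.
elim/tensor_ind: t => [|x y Hx Hy|b c]; first exact: tmul0l.
  by rewrite tmulBl Hx Hy subrr.
by rewrite tmul_pure tmulr0.
Qed.

Let tmulBr t s s' : tmul t (s - s') = tmul t s - tmul t s'.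
Proof.
elim/tensor_ind: t => [|x y Hx Hy|b c]; first by rewrite !tmul0l subrr.
  by rewrite !tmulBl Hx Hy !opprB addrACA [RHS]addrACA [X in _ + X = _]addrC.
by rewrite !tmul_pure tmulrB.
Qed.

Lemma tmulC : commutative tmul.
Proof.
move=> s t; elim/tensor_ind: s => [|x y Hx Hy|b c]; first by rewrite tmul0l tmul0r.
  by rewrite tmulBl tmulBr Hx Hy.
elim/tensor_ind: t => [|x y Hx Hy|b' c']; first by rewrite tmul0l tmul0r.
  by rewrite tmulBl tmulBr Hx Hy.
by rewrite !tpureM mulrC [c * _]mulrC.
Qed.

Lemma tmulA : associative tmul.
Proof.
move=> r s t; elim/tensor_ind: r => [|x y Hx Hy|b c]; first by rewrite !tmul0l.
  by rewrite !tmulBl Hx Hy.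
elim/tensor_ind: s => [|x y Hx Hy|b' c']; first by rewrite !(tmul0l, tmul0r).
  by rewrite !(tmulBl, tmulBr) Hx Hy.
elim/tensor_ind: t => [|x y Hx Hy|d e]; first by rewrite !tmul0r.
  by rewrite !tmulBr Hx Hy.
by rewrite !tpureM !mulrA.
Qed.

Lemma tmul1 : left_id tone tmul.
Proof.
elim/tensor_ind=> [|x y Hx Hy|b c]; first exact: tmul0r.
  by rewrite tmulBr Hx Hy.
by rewrite tpureM !mul1r.
Qed.

Lemma tmulDl : left_distributive tmul +%R.
Proof. by move=> x y z; exact: (tensor_liftD (tmul_bal z)). Qed.

HB.instance Definition _ :=
  GRing.Zmodule_isComPzRing.Build tensor tmulA tmulC tmul1 tmulDl.

Lemma tensorM_pure b c b' c' : tpure b c * tpure b' c' = tpure (b * b') (c * c').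
Proof. exact: tpureM. Qed.

Definition tensor_inl (b : B) : tensor := tpure b 1.

Lemma tensor_inl_zmod_morphism : zmod_morphism tensor_inl.
Proof.
by move=> x y; apply/eqP; rewrite eq_sym subr_eq /tensor_inl -tpureDl subrK.
Qed.

Lemma tensor_inl_monoid_morphism : monoid_morphism tensor_inl.
Proof. by split=> [//|x y]; rewrite /tensor_inl tensorM_pure mulr1. Qed.

HB.instance Definition _ :=
  GRing.isZmodMorphism.Build B tensor tensor_inl tensor_inl_zmod_morphism.
HB.instance Definition _ :=
  GRing.isMonoidMorphism.Build B tensor tensor_inl tensor_inl_monoid_morphism.

End Tensor.

Definition ring_isomorphism (R S : comPzRingType) (f : {rmorphism R -> S}) : Prop :=
  bijective f.

Section Epimorphism.
Variables (A B : comPzRingType) (u : {rmorphism A -> B}).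

Definition tensor_mult : tensor u u -> B := tensor_lift *%R.

Let mult_bal : balanced u u (@GRing.mul B).
Proof. by split=> *; rewrite ?mulrDl ?mulrDr // mulrCA mulrA. Qed.

Lemma tensor_mult_pure b c : tensor_mult (tpure u u b c) = b * c.
Proof. exact/tensor_lift_pure/mult_bal. Qed.

Lemma tensor_mult_zmod_morphism : zmod_morphism tensor_mult.
Proof. exact/tensor_liftB/mult_bal. Qed.

HB.instance Definition _ :=
  GRing.isZmodMorphism.Build (tensor u u) B tensor_mult tensor_mult_zmod_morphism.

Let tensor_mult0 : tensor_mult 0 = 0.
Proof. exact/tensor_lift0/mult_bal. Qed.

Lemma tensor_mult_monoid_morphism : monoid_morphism tensor_mult.
Proof.
split=> [|s t]; first by rewrite tensor_mult_pure mulr1.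
elim/tensor_ind: s => [|x y Hx Hy|b c]; first by rewrite mul0r tensor_mult0 mul0r.
  by rewrite mulrBl !tensor_mult_zmod_morphism Hx Hy mulrBl.
elim/tensor_ind: t => [|x y Hx Hy|b' c']; first by rewrite mulr0 tensor_mult0 mulr0.
  by rewrite mulrBr !tensor_mult_zmod_morphism Hx Hy mulrBr.
by rewrite tensorM_pure !tensor_mult_pure mulrACA.
Qed.

HB.instance Definition _ :=
  GRing.isMonoidMorphism.Build (tensor u u) B tensor_mult tensor_mult_monoid_morphism.

Definition ring_epimorphism : Prop := ring_isomorphism tensor_mult.

End Epimorphism.

Record Spec (A : comPzRingType) := MkSpec {
  spec_pred :> {pred A};
  spec0 : 0 \in spec_pred;
  specD : forall x y, x \in spec_pred -> y \in spec_pred -> x + y \in spec_pred;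
  specMl : forall a x, x \in spec_pred -> a * x \in spec_pred;
  spec1 : 1 \notin spec_pred;
  spec_prime : forall x y,
    x * y \in spec_pred -> (x \in spec_pred) || (y \in spec_pred)
}.

Section Localization.
Variables (A : comPzRingType) (P : Spec A).

(* Formal fractions a / s with s outside P. *)
Definition prefrac := {x : A * A | x.2 \notin P}.

Lemma specCM s t : s \notin P -> t \notin P -> s * t \notin P.
Proof. by move=> sP tP; apply/negP => /spec_prime; rewrite (negPf sP) (negPf tP). Qed.

Definition mkfrac a s (sP : s \notin P) : prefrac := exist _ (a, s) sP.
Definition prefrac_cst a : prefrac := mkfrac a (spec1 P).
Definition prefrac_opp (x : prefrac) : prefrac := mkfrac (- (val x).1) (valP x).
Definition prefrac_add (x y : prefrac) : prefrac :=
  mkfrac ((val x).1 * (val y).2 + (val y).1 * (val x).2) (specCM (valP x) (valP y)).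
Definition prefrac_mul (x y : prefrac) : prefrac :=
  mkfrac ((val x).1 * (val y).1) (specCM (valP x) (valP y)).

Definition frac_equiv (x y : prefrac) : bool :=
  `[< exists2 w, w \notin P &
      w * ((val x).1 * (val y).2) = w * ((val y).1 * (val x).2) >].

Lemma frac_equiv_is_equiv : equiv_class_of frac_equiv.
Proof.
split=> [x|x y|y x z].
- by apply/asboolP; exists 1 => //; exact: spec1.
- by apply/asboolP/asboolP => -[w wP e]; exists w.
- case: x y z => [[a s] /= sP] [[b t] /= tP] [[c r] /= rP].
  move=> /asboolP/= [w wP e] /asboolP/= [w' wP' e'].
  apply/asboolP; exists (w * w' * t) => /=; first by rewrite !specCM.
  have -> : w * w' * t * (a * r) = w' * r * (w * (a * t)) by ring.
  rewrite e; have -> : w' * r * (w * (b * s)) = w * s * (w' * (b * r)) by ring.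
  by rewrite e'; ring.
Qed.
Canonical frac_equiv_equiv := EquivRelPack frac_equiv_is_equiv.
Canonical frac_equiv_encModRel := defaultEncModRel frac_equiv.

Definition localization : Type := {eq_quot frac_equiv}.
HB.instance Definition _ := EqQuotient.on localization.
HB.instance Definition _ := Choice.on localization.


Local Notation pi := \pi_localization.

Lemma frac_eqP (x y : prefrac) :
  pi x = pi y <-> exists2 w, w \notin P &
    w * ((val x).1 * (val y).2) = w * ((val y).1 * (val x).2).
Proof.
by split=> [/eqP|H]; [|apply/eqP]; rewrite piE => *; exact/asboolP.
Qed.

Definition loc_zero : localization := lift_cst localization (prefrac_cst 0).
Definition loc_one : localization := lift_cst localization (prefrac_cst 1).
Definition loc_opp := lift_op1 localization prefrac_opp.
Definition loc_add := lift_op2 localization prefrac_add.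
Definition loc_mul := lift_op2 localization prefrac_mul.

Let loc_zeroE : loc_zero = pi (prefrac_cst 0).
Proof. by unlock loc_zero. Qed.

Let loc_oneE : loc_one = pi (prefrac_cst 1).
Proof. by unlock loc_one. Qed.

Let frac_repr x : exists2 w, w \notin P &
  w * ((val (repr (pi x))).1 * (val x).2) = w * ((val x).1 * (val (repr (pi x))).2).
Proof. by apply/frac_eqP; rewrite reprK. Qed.

Let loc_oppE x : loc_opp (pi x) = pi (prefrac_opp x).
Proof.
unlock loc_opp; apply/frac_eqP; have [w wP e] := frac_repr x.
by exists w => //=; rewrite !mulNr !mulrN e.
Qed.

Let loc_addE x y : loc_add (pi x) (pi y) = pi (prefrac_add x y).
Proof.
unlock loc_add; apply/frac_eqP; have [w wP e] := frac_repr x; have [w' w'P e'] := frac_repr y.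
exists (w * w') => /=; first exact: specCM.
case: (repr (pi x)) (repr (pi y)) e e' => p pP [q qP] /=.
case: x y => [r rP] [t tP] /= e e'.
transitivity (w' * q.2 * t.2 * (w * (p.1 * r.2)) + w * p.2 * r.2 * (w' * (q.1 * t.2))).
  by ring.
by rewrite e e'; ring.
Qed.

Let loc_mulE x y : loc_mul (pi x) (pi y) = pi (prefrac_mul x y).
Proof.
unlock loc_mul; apply/frac_eqP; have [w wP e] := frac_repr x; have [w' w'P e'] := frac_repr y.
exists (w * w') => /=; first exact: specCM.
case: (repr (pi x)) (repr (pi y)) e e' => p pP [q qP] /=.
case: x y => [r rP] [t tP] /= e e'.
transitivity ((w * (p.1 * r.2)) * (w' * (q.1 * t.2))); first by ring.
by rewrite e e'; ring.
Qed.

Let fracE x y : (val x).1 * (val y).2 = (val y).1 * (val x).2 -> pi x = pi y.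
Proof. by move=> e; apply/frac_eqP; exists 1; rewrite ?spec1 ?e. Qed.

Lemma loc_addA : associative loc_add.
Proof.
elim/quotW=> x; elim/quotW=> y; elim/quotW=> z; rewrite !loc_addE.
by apply: fracE => /=; ring.
Qed.

Lemma loc_addC : commutative loc_add.
Proof.
elim/quotW=> x; elim/quotW=> y; rewrite !loc_addE.
by apply: fracE => /=; ring.
Qed.

Lemma loc_add0 : left_id loc_zero loc_add.
Proof.
elim/quotW=> x; rewrite loc_zeroE loc_addE.
by apply: fracE => /=; ring.
Qed.

Lemma loc_addN : left_inverse loc_zero loc_opp loc_add.
Proof.
elim/quotW=> x; rewrite loc_zeroE loc_oppE loc_addE.
by apply: fracE => /=; ring.
Qed.

HB.instance Definition _ :=
  GRing.isZmodule.Build localization loc_addA loc_addC loc_add0 loc_addN.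

Lemma loc_mulA : associative loc_mul.
Proof.
elim/quotW=> x; elim/quotW=> y; elim/quotW=> z; rewrite !loc_mulE.
by apply: fracE => /=; ring.
Qed.

Lemma loc_mulC : commutative loc_mul.
Proof.
elim/quotW=> x; elim/quotW=> y; rewrite !loc_mulE.
by apply: fracE => /=; ring.
Qed.

Lemma loc_mul1 : left_id loc_one loc_mul.
Proof.
elim/quotW=> x; rewrite loc_oneE loc_mulE.
by apply: fracE => /=; ring.
Qed.

Lemma loc_mulDl : left_distributive loc_mul +%R.
Proof.
elim/quotW=> x; elim/quotW=> y; elim/quotW=> z.
change (loc_mul (loc_add (pi x) (pi y)) (pi z) =
  loc_add (loc_mul (pi x) (pi z)) (loc_mul (pi y) (pi z))).
rewrite loc_addE !loc_mulE loc_addE.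
by apply: fracE => /=; ring.
Qed.

Lemma loc_oner_neq0 : loc_one != 0.
Proof.
rewrite loc_oneE; apply/eqP; rewrite -[0]/loc_zero loc_zeroE => /frac_eqP[w wP] /=.
by rewrite !mulr1 mulr0 => w0; rewrite w0 spec0 in wP.
Qed.

HB.instance Definition _ := GRing.Zmodule_isComNzRing.Build localization
  loc_mulA loc_mulC loc_mul1 loc_mulDl loc_oner_neq0.

Definition frac a s (sP : s \notin P) : localization := pi (mkfrac a sP).

Lemma eq_frac a s (sP : s \notin P) b t (tP : t \notin P) :
  frac a sP = frac b tP <-> exists2 w, w \notin P & w * (a * t) = w * (b * s).
Proof. exact: frac_eqP. Qed.

Lemma frac_ind (Q : localization -> Prop) :
  (forall a s (sP : s \notin P), Q (frac a sP)) -> forall x, Q x.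
Proof. by move=> H; elim/quotW => -[[a s] sP]; exact: H. Qed.

Lemma addfrac a s (sP : s \notin P) b t (tP : t \notin P) :
  frac a sP + frac b tP = frac (a * t + b * s) (specCM sP tP).
Proof.
change (loc_add (frac a sP) (frac b tP) = frac (a * t + b * s) (specCM sP tP)).
by rewrite loc_addE; congr (pi _); apply: val_inj.
Qed.

Lemma mulfrac a s (sP : s \notin P) b t (tP : t \notin P) :
  frac a sP * frac b tP = frac (a * b) (specCM sP tP).
Proof.
change (loc_mul (frac a sP) (frac b tP) = frac (a * b) (specCM sP tP)).
by rewrite loc_mulE; congr (pi _); apply: val_inj.
Qed.

Definition loc (a : A) : localization := frac a (spec1 P).

Lemma loc_zmod_morphism : zmod_morphism loc.
Proof.
move=> a b; apply/eqP; rewrite eq_sym subr_eq; apply/eqP.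
by rewrite addfrac; apply: fracE => /=; ring.
Qed.

Lemma loc_monoid_morphism : monoid_morphism loc.
Proof. by split=> [//|a b]; rewrite mulfrac; apply: fracE => /=; ring. Qed.

HB.instance Definition _ := GRing.isZmodMorphism.Build A localization loc loc_zmod_morphism.
HB.instance Definition _ :=
  GRing.isMonoidMorphism.Build A localization loc loc_monoid_morphism.

(* The extended ideal P A_P: finite sums of multiples of images of elements    *)
(* of P.                                                                       *)
Definition extended_ideal : {pred localization} := fun x =>
  `[< exists2 s : seq (localization * A), (forall y, y \in s -> y.2 \in P) &
      x = \sum_(y <- s) y.1 * loc y.2 >].

Lemma extended_idealP x : x \in extended_ideal ->
  exists a s (sP : s \notin P), a \in P /\ x = frac a sP.
Proof.
move=> /asboolP[s sP ->] {x}.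
elim: s sP => [_|[y b] s IH sP].
  by exists 0, 1, (spec1 P); rewrite big_nil spec0.
have [|a [t [tP [aP e]]]] := IH; first by move=> y' y's; apply: sP; rewrite inE y's orbT.
have bP : b \in P by apply: (sP (y, b)); rewrite inE eqxx.
rewrite big_cons e /=; elim/frac_ind: y sP => c r rP _.
rewrite mulfrac addfrac; eexists; eexists; eexists; split; last by [].
by rewrite specD // mulrC specMl // specMl.
Qed.

Lemma extended_ideal_closed : idealr_closed extended_ideal.
Proof.
split.
- by apply/asboolP; exists [::]; rewrite ?big_nil.
- apply/negP => /extended_idealP[a [s [sP [aP]]]].
  rewrite -(rmorph1 loc) => /eq_frac[w wP].
  rewrite mul1r mulr1 => e; move: (specCM wP sP).
  by rewrite e specMl.
- move=> c x y /asboolP[s sP ->] /asboolP[t tP ->]; apply/asboolP.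
  exists ([seq (c * z.1, z.2) | z <- s] ++ t).
    by move=> z; rewrite mem_cat => /orP[/mapP[z' /sP z'P ->]|/tP].
  rewrite big_cat big_map mulr_sumr; congr (_ + _).
  by apply: eq_bigr => z _; rewrite mulrA.
Qed.

HB.instance Definition _ :=
  isIdealr.Build localization extended_ideal extended_ideal_closed.

Definition residue_field : Type := {ideal_quot extended_ideal}.
HB.instance Definition _ := GRing.ComNzRing.on residue_field.

Definition residue_map (a : A) : residue_field := \pi_{ideal_quot extended_ideal} (loc a).

Lemma residue_map_zmod_morphism : zmod_morphism residue_map.
Proof. by move=> a b; rewrite /residue_map !raddfB. Qed.

Lemma residue_map_monoid_morphism : monoid_morphism residue_map.
Proof. by rewrite /residue_map; split=> [|a b]; rewrite ?rmorph1 ?rmorphM. Qed.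

HB.instance Definition _ :=
  GRing.isZmodMorphism.Build A residue_field residue_map residue_map_zmod_morphism.
HB.instance Definition _ :=
  GRing.isMonoidMorphism.Build A residue_field residue_map residue_map_monoid_morphism.

End Localization.

(* The canonical map of the definition is the left inclusion x |-> x (x) 1 of  *)
(* the residue field of A at P into its tensor product with B over A.          *)
Definition strong_PSI_morphism (A B : comPzRingType) (u : {rmorphism A -> B}) : Prop :=
  forall P : Spec A,
    (exists x : tensor (residue_map P) u, x != 0) ->
    ring_isomorphism (tensor_inl (residue_map P) u).

(* Main.v *)
Require Import Defs.
From mathcomp Require Import all_boot all_algebra.
From mathcomp Require Import generic_quotient ring_quotient boolp classical_sets ring.

Set Implicit Arguments.
Unset Strict Implicit.
Unset Printing Implicit Defensive.

Import GRing.Theory.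
Local Open Scope ring_scope.

(** Let K be the residue field of A at P and C the tensor product of K and B
    over A, assumed nonzero.  The map K -> C is injective because K is a field,
    so everything is in its surjectivity.

    Since u is an epimorphism, b (x) 1 = 1 (x) b in the tensor square of B, so
    any A-balanced map h on B x B satisfies h b 1 = h 1 b
    ([epimorphism_balanced]).  Choose a K-linear retraction phi of K -> C,
    which exists because C is a nonzero vector space
    ([field_linear_retraction]), and take
      h b b' = phi (1 (x) b) * (1 (x) b').
    The symmetry of h reads phi (1 (x) b) * 1 = 1 (x) b, so that each
    1 (x) b, and therefore all of C, comes from K ([epimorphism_retraction]).
    This replaces the usual comparison of the dimensions of C and of its tensor
    square over K, and needs no basis of C. *)

Definition is_field (K : comPzRingType) : Prop :=
  forall x : K, x != 0 -> exists y, y * x = 1.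

Lemma residue_field_is_field (A : comPzRingType) (P : Spec A) :
  is_field (residue_field P).
Proof.
elim/quotW=> x; elim/frac_ind: x => a s sP nz.
(* A fraction a / s with a in P lies in the extended ideal, hence vanishes in
   the residue field; otherwise s / a is an inverse. *)
have aP : a \notin P.
  apply: contra nz => aP; rewrite -[X in _ == X](raddf0 (\pi_(residue_field P)))%qT.
  rewrite -Quotient.idealrBE subr0; apply/asboolP.
  exists [:: (Defs.frac 1 sP, a)]; first by move=> y; rewrite inE => /eqP ->.
  rewrite big_seq1 mulfrac; apply/eq_frac; exists 1; first exact: spec1.
  by rewrite /=; ring.
exists (\pi_(residue_field P) (Defs.frac s aP))%qT.
rewrite -rmorphM -[RHS](rmorph1 (\pi_(residue_field P)))%qT; congr (\pi _)%qT.
rewrite mulfrac -(rmorph1 (loc P)); apply/eq_frac; exists 1; first exact: spec1.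
by ring.
Qed.

Section LinearRetraction.
Variables (K C : comPzRingType) (f : {rmorphism K -> C}).

Definition linear_retraction (phi : C -> K) : Prop :=
  [/\ forall x y, phi (x + y) = phi x + phi y,
      forall k x, phi (f k * x) = k * phi x & phi 1 = 1].

(** The empty set is allowed, since Zorn's lemma for unions applies to the
    empty chain too. *)
Definition avoiding_subspace (W : set C) : Prop :=
  (forall k x y, W x -> W y -> W (f k * x + y)) /\ ~ W 1.

Lemma maximal_avoiding_subspace : (1 : C) != 0 ->
  exists W : set C, [/\ avoiding_subspace W, W 0 &
    forall W', avoiding_subspace W' -> W `<=` W' -> W' `<=` W]%classic.
Proof.
move=> C1.
have [F FP Ftot|W [WP Wmax]] := @Zorn_bigcup C avoiding_subspace.
  split=> [k x y [X FX Xx] [Y FY Yy]|[X FX X1]]; last by case: (FP X FX).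
  case: (Ftot X Y FX FY) => [XY|YX].
  - by exists Y => //; apply: (FP Y FY).1 => //; exact: XY.
  - by exists X => //; apply: (FP X FX).1 => //; exact: YX.
have Wmax' W' : avoiding_subspace W' -> (W `<=` W' -> W' `<=` W)%classic.
  by move=> W'P WW'; apply: contrapT => nW; apply: (Wmax W').
have [[w Ww]|W0] := pselect (exists w, W w).
  exists W; split=> //; have [Wlin _] := WP.
  by rewrite -(addNr w) -mulN1r -(rmorph1 f) -rmorphN; exact: Wlin.
exfalso; apply: (W0); exists 0; apply: (Wmax' [set 0]%classic) => //.
  split=> [k x y /= -> ->|/= /eqP]; first by rewrite mulr0 addr0.
  exact/negP.
by move=> w Ww; case: W0; exists w.
Qed.

(** A maximal subspace W that does not contain 1 is a complement of the line
    f K: for x outside W, the maximality of W puts 1 in W + (f K) x, and the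
    coefficient of x is invertible.  The retraction is then the projection
    along W. *)
Lemma field_linear_retraction : is_field K -> (1 : C) != 0 ->
  exists phi, linear_retraction phi.
Proof.
move=> Kf /maximal_avoiding_subspace[W [[Wlin W1] W0 Wmax]].
have WZ k x : W x -> W (f k * x) by move=> Wx; rewrite -[_ * _]addr0; exact: Wlin.
have WD x y : W x -> W y -> W (x + y).
  by move=> Wx Wy; rewrite -[x]mul1r -(rmorph1 f); exact: Wlin.
have WB x y : W x -> W y -> W (x - y).
  by move=> Wx Wy; apply: WD => //; rewrite -mulN1r -(rmorph1 f) -rmorphN; exact: WZ.
have uniq_coef k : W (f k) -> k = 0.
  move=> Wk; apply/eqP; apply: contrapT => /negP/Kf[l lk]; apply: W1.
  by rewrite -(rmorph1 f) -lk rmorphM; exact: WZ.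
have ex_coef x : exists k, W (x - f k).
  (* W' is the subspace generated by W and x. *)
  pose W' : set C := fun z => exists k, W (z - f k * x).
  have [[k Wk]|W'1] := pselect (W' 1); last first.
    exists 0; rewrite rmorph0 subr0; apply: (Wmax W').
    - split=> // k y z [l Wl] [m Wm]; exists (k * l + m).
      suff -> : f k * y + z - f (k * l + m) * x =
        f k * (y - f l * x) + (z - f m * x) by exact: Wlin.
      by rewrite rmorphD rmorphM; ring.
    - by move=> w Ww; exists 0; rewrite rmorph0 mul0r subr0.
    - by exists 1; rewrite rmorph1 mul1r subrr.
  have k0 : k != 0.
    by apply/eqP => k0; apply: W1; rewrite k0 rmorph0 mul0r subr0 in Wk.
  have [l lk] := Kf k k0; exists l.
  suff -> : x - f l = f (- l) * (1 - f k * x) by exact: WZ.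
  have flk : f l * f k = 1 by rewrite -rmorphM lk rmorph1.
  by rewrite rmorphN mulrBr mulr1 mulrA mulNr flk; ring.
have [phi phiP] := choice ex_coef.
have phiE x k : W (x - f k) -> phi x = k.
  move=> Wk; apply/eqP; rewrite -subr_eq0; apply/eqP/uniq_coef.
  suff -> : f (phi x - k) = (x - f k) - (x - f (phi x)) by exact: WB.
  by rewrite rmorphB; ring.
exists phi; split=> [x y|k x|]; apply: phiE.
- suff -> : x + y - f (phi x + phi y) = (x - f (phi x)) + (y - f (phi y)).
    exact: WD.
  by rewrite rmorphD; ring.
- by rewrite rmorphM -mulrBr; exact: WZ.
- by rewrite rmorph1 subrr.
Qed.

End LinearRetraction.

(** The elements b (x) 1 and 1 (x) b of the tensor square of B have the same
    product b, so they are equal when multiplication is injective. *)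
Lemma epimorphism_balanced (A B : comPzRingType) (u : {rmorphism A -> B})
    (V : zmodType) (h : B -> B -> V) (b : B) :
  ring_epimorphism u -> balanced u u h -> h b 1 = h 1 b.
Proof.
move=> /bij_inj mult_inj hP.
rewrite -(tensor_lift_pure hP) -[RHS](tensor_lift_pure hP).
suff -> : tpure u u b 1 = tpure u u 1 b by [].
by apply: mult_inj; rewrite /= !tensor_mult_pure mulr1 mul1r.
Qed.

(** Over any base ring K, the base change of an epimorphism is surjective as
    soon as it has a K-linear retraction phi: the map h below is A-balanced
    because phi is K-linear, and its symmetry expresses 1 (x) b as the image of
    phi (1 (x) b). *)
Lemma epimorphism_retraction (A B K : comPzRingType) (u : {rmorphism A -> B})
    (r : {rmorphism A -> K}) (phi : tensor r u -> K) :
  ring_epimorphism u -> linear_retraction (tensor_inl r u) phi ->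
  forall t, exists k, t = tensor_inl r u k.
Proof.
move=> uepi [phiD phiZ phi1].
have pureE k b : tpure r u k b = tensor_inl r u k * tpure r u 1 b.
  by rewrite tensorM_pure mulr1 mul1r.
have pureA a b : tpure r u 1 (u a * b) = tensor_inl r u (r a) * tpure r u 1 b.
  by rewrite -tpureA mulr1 pureE.
pose h b b' := tensor_inl r u (phi (tpure r u 1 b)) * tpure r u 1 b'.
have hP : balanced u u h.
  split=> [b b' c|b c c'|a b c]; rewrite /h.
  - by rewrite tpureDr phiD rmorphD mulrDl.
  - by rewrite tpureDr mulrDr.
  - by rewrite !pureA phiZ rmorphM mulrCA mulrA.
have pure_inl b : tpure r u 1 b = tensor_inl r u (phi (tpure r u 1 b)).
  have := epimorphism_balanced b uepi hP; rewrite /h.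
  by rewrite -[tpure r u 1 1]/(1 : tensor r u) phi1 rmorph1 mulr1 mul1r.
elim/tensor_ind=> [|_ _ [k ->] [l ->]|k b].
- by exists 0; rewrite rmorph0.
- by exists (k - l); rewrite rmorphB.
- by exists (k * phi (tpure r u 1 b)); rewrite pureE {1}pure_inl rmorphM.
Qed.

Lemma field_morphism_inj (K C : comPzRingType) (f : {rmorphism K -> C}) :
  is_field K -> (1 : C) != 0 -> injective f.
Proof.
move=> Kf C1 x y fxy; apply/eqP; rewrite -subr_eq0.
apply: contrapT => /negP/Kf[z zP]; move/eqP: C1; apply.
by rewrite -(rmorph1 f) -zP rmorphM rmorphB fxy subrr mulr0.
Qed.

Theorem proposition3p2 (A B : comPzRingType) (u : {rmorphism A -> B}) :
  ring_epimorphism u -> strong_PSI_morphism u.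
Proof.
move=> uepi P [x x0].
have Kf := @residue_field_is_field A P.
have C1 : (1 : tensor (residue_map P) u) != 0.
  by apply: contra x0 => /eqP C10; rewrite -[x]mul1r C10 mul0r.
have [phi /(epimorphism_retraction uepi) surj] :=
  field_linear_retraction (tensor_inl (residue_map P) u) Kf C1.
have [g gP] := choice surj.
have gK : cancel g (tensor_inl (residue_map P) u) by move=> t; rewrite -gP.
by exists g => //; apply: inj_can_sym gK _; exact: field_morphism_inj.
Qed.
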